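(* Let $\mathbb{F}$ be an infinite field of arbitrary characteristic, let $\mathsf{A}_1$ be the Weyl algebra over $\mathbb{F}$ with generators $x,y$, and let $\mathsf{V}=\mathbb{F}\text{-}\mathrm{span}\{x,y\}\subset\mathsf{A}_1$. Any weak polynomial identity for the pair $(\mathsf{A}_1,\mathsf{V})$ of degree $5$ lies in the L-ideal $\mathcal{I}$ of $\mathbb{F}\langle X\rangle$ generated by $\Gamma_3$, $\mathrm{St}_3$, and $T_4$.
   Context: The Weyl algebra is the unital associative algebra $\mathsf{A}_1=\mathbb{F}\langle x,y\rangle/(yx-xy-1)$. $\mathbb{F}\langle X\rangle$ is the free unital associative $\mathbb{F}$-algebra on free generators $x_1,x_2,\ldots$. A weak polynomial identity for the pair $(\mathsf{A}_1,\mathsf{V})$ is an element $f(x_1,\ldots,x_m)\in\mathbb{F}\langle X\rangle$ such that $f(v_1,\ldots,v_m)=0$ in $\mathsf{A}_1$ for all $v_1,\ldots,v_m\in\mathsf{V}$. With $[a,b]=ab-ba$, put $$\Gamma_3(x_1,x_2,x_3)=[[x_1,x_2],x_3],\qquad \mathrm{St}_3(x_1,x_2,x_3)=x_1[x_2,x_3]-x_2[x_1,x_3]+x_3[x_1,x_2],$$ $$T_4(x_1,x_2,x_3,x_4)=[x_1,x_2][x_3,x_4]-[x_1,x_3][x_2,x_4]+[x_2,x_3][x_1,x_4].$$ The L-ideal generated by $f_1,\ldots,f_k\in\mathbb{F}\langle X\rangle$ is the $\mathbb{F}$-span of all $f^{(1)}f_i(g_1,\ldots,g_m)f^{(2)}$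 with $f^{(1)},f^{(2)}\in\mathbb{F}\langle X\rangle$, $g_1,\ldots,g_m$ linear combinations of letters $x_1,x_2,\ldots$, and $1\le i\le k$. Thus $\mathcal{I}$ is the two-sided ideal of $\mathbb{F}\langle X\rangle$ generated by $\Gamma_3(x_i,x_j,x_k)$, $\mathrm{St}_3(x_i,x_j,x_k)$, $T_4(x_i,x_j,x_k,x_l)$ for all $i,j,k,l>0$. *)

(* Defs.v *)
From HB Require Import structures.
From mathcomp Require Import all_boot all_order all_algebra finmap.
From mathcomp Require Import boolp classical_sets cardinality.
From mathcomp Require Import monalg.

Set Implicit Arguments.
Unset Strict Implicit.
Unset Printing Implicit Defensive.

Import GRing.Theory.
Local Open Scope ring_scope.
Local Open Scope quotient_scope.
Local Open Scope classical_set_scope.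

(* The free unital associative F-algebra on the set I of free generators.
   [monalg] provides no [algType] structure for {malg F[{fmonom I}]}, whence
   the alias. *)
Definition freealg (F : fieldType) (I : choiceType) := {malg F[{fmonom I}]}.

HB.instance Definition _ (F : fieldType) (I : choiceType) :=
  GRing.Lalgebra.on (freealg F I).

Lemma malg_scaleAr (M : monomType) (R : comNzRingType) (c : R)
  (f g : {malg R[M]}) : c *: (f * g) = f * (c *: g).
Proof.
apply/malgP => k; rewrite mcoeffZ !mcoeffMl mulr_sumr; apply: eq_bigr => i _.
have sub := msuppZ_le c g.
rewrite mulr_sumr [RHS](big_fset_incl _ sub) /=; last first.
  by move=> j _ /mcoeff_outdom ->; rewrite mulr0 mul0rn.
by apply: eq_bigr => j _; rewrite mcoeffZ mulrnAr mulrCA.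
Qed.

HB.instance Definition _ (F : fieldType) (I : choiceType) :=
  GRing.Lalgebra_isAlgebra.Build F (freealg F I) (@malg_scaleAr {fmonom I} F).

Definition fvar (F : fieldType) (I : choiceType) (i : I) : freealg F I :=
  << fmu i >>.

(* f(v_1, v_2, ...) for a family v of elements of an F-algebra A *)
Definition feval (F : fieldType) (I : choiceType) (A : algType F) (v : I -> A)
    (f : freealg F I) : A :=
  mmap (in_alg A) (fun w : {fmonom I} => \prod_(i <- w) v i) f.

(* The total degree, with the convention that 0 has degree 0. *)
Definition fdegree (F : fieldType) (I : choiceType) (f : freealg F I) : nat :=
  \max_(w <- msupp f) fdeg w.

Definition linspan (F : fieldType) (V : lmodType F) (S : set V) : set V :=
  [set u | exists2 s : seq (F * V),
     {in s, forall t, S t.2} & u = \sum_(t <- s) t.1 *: t.2].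

Definition ideal_gen (R : pzRingType) (S : set R) : set R :=
  [set a | exists2 s : seq (R * R * R),
     {in s, forall t, S t.1.2} & a = \sum_(t <- s) t.1.1 * t.1.2 * t.2].

Section IdealGenTheory.
Variables (R : pzRingType) (S : set R).

Lemma ideal_gen0 : ideal_gen S 0.
Proof. by exists [::] => //; rewrite big_nil. Qed.

Lemma ideal_genD a b : ideal_gen S a -> ideal_gen S b -> ideal_gen S (a + b).
Proof.
move=> [s Ss ->] [t St ->]; exists (s ++ t); last by rewrite big_cat.
by move=> u; rewrite mem_cat => /orP[/Ss|/St].
Qed.

Lemma ideal_genM l a r : ideal_gen S a -> ideal_gen S (l * a * r).
Proof.
move=> [s Ss ->]; exists [seq (l * t.1.1, t.1.2, t.2 * r) | t <- s].
  by move=> _ /mapP[t ts ->]; exact: Ss ts.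
rewrite big_map mulr_sumr mulr_suml.
by apply: eq_bigr => t _; rewrite !mulrA.
Qed.

Lemma ideal_genMl l a : ideal_gen S a -> ideal_gen S (l * a).
Proof. by move=> /(ideal_genM l 1); rewrite mulr1. Qed.

Lemma ideal_genMr r a : ideal_gen S a -> ideal_gen S (a * r).
Proof. by move=> /(ideal_genM 1 r); rewrite mul1r. Qed.

Lemma ideal_genB a b : ideal_gen S a -> ideal_gen S b -> ideal_gen S (a - b).
Proof.
by move=> Sa Sb; apply: ideal_genD => //; rewrite -mulN1r; apply: ideal_genMl.
Qed.

Lemma ideal_gen_mulB a b a' b' : ideal_gen S (a - a') ->
  ideal_gen S (b - b') -> ideal_gen S (a * b - a' * b').
Proof.
move=> Sa Sb.
have -> : a * b - a' * b' = (a - a') * b + a' * (b - b').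
  by rewrite mulrBl mulrBr addrA subrK.
by apply: ideal_genD; [apply: ideal_genMr|apply: ideal_genMl].
Qed.

Lemma ideal_gen_incl a : S a -> ideal_gen S a.
Proof.
move=> Sa; exists [:: (1, a, 1)]; last by rewrite big_seq1 mul1r mulr1.
by move=> t; rewrite inE => /eqP ->.
Qed.

End IdealGenTheory.

(* The Weyl algebra, as the quotient of F<x, y> by the two-sided ideal
   generated by yx - xy - 1; the free generators are indexed by bool, x being
   [fvar F false] and y being [fvar F true]. *)
Section Weyl.
Variable F : fieldType.

Local Notation Fxy := (freealg F bool).
Local Notation X := (fvar F false).
Local Notation Y := (fvar F true).

Definition weyl_ideal : {pred Fxy} :=
  fun f => `[< ideal_gen [set Y * X - X * Y - 1] f >].

Lemma weyl_idealP f :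
  reflect (ideal_gen [set Y * X - X * Y - 1] f) (f \in weyl_ideal).
Proof. exact: asboolP. Qed.

Fact weyl_ideal_zmod_closed : zmod_closed weyl_ideal.
Proof.
split; first by apply/weyl_idealP; exact: ideal_gen0.
by move=> f g /weyl_idealP ? /weyl_idealP ?; apply/weyl_idealP; exact: ideal_genB.
Qed.

HB.instance Definition _ :=
  GRing.isZmodClosed.Build Fxy weyl_ideal weyl_ideal_zmod_closed.

Definition weyl := {ideal_quot weyl_ideal}.

HB.instance Definition _ := GRing.Zmodule.on weyl.

Definition weyl_pi (f : Fxy) : weyl := \pi_weyl f.

Lemma weyl_piP f g : weyl_pi f = weyl_pi g <-> f - g \in weyl_ideal.
Proof.
have e := Quotient.idealrBE weyl_ideal f g; rewrite e.
by split=> /eqP.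
Qed.

Lemma weyl_repr_pi f : f - repr (weyl_pi f) \in weyl_ideal.
Proof. by apply/weyl_piP; rewrite /weyl_pi reprK. Qed.

Lemma weyl_ind (P : weyl -> Prop) : (forall f, P (weyl_pi f)) -> forall u, P u.
Proof. by move=> H u; rewrite -[u]reprK; exact: H. Qed.

Fact weyl_pi_zmod : zmod_morphism weyl_pi.
Proof. by move=> f g; rewrite /weyl_pi /= !piE. Qed.

HB.instance Definition _ :=
  GRing.isZmodMorphism.Build Fxy weyl weyl_pi weyl_pi_zmod.

Definition weyl_mul (u v : weyl) : weyl := weyl_pi (repr u * repr v).
Definition weyl_scale (c : F) (u : weyl) : weyl := weyl_pi (c *: repr u).

Lemma weyl_piM f g : weyl_mul (weyl_pi f) (weyl_pi g) = weyl_pi (f * g).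
Proof.
apply/esym/weyl_piP/weyl_idealP.
set f' := repr _; set g' := repr _.
apply: ideal_gen_mulB; apply/weyl_idealP; exact: weyl_repr_pi.
Qed.

Lemma weyl_piZ c f : weyl_scale c (weyl_pi f) = weyl_pi (c *: f).
Proof.
apply/esym/weyl_piP/weyl_idealP; rewrite -scalerBr.
rewrite -mulr_algl.
by apply: ideal_genMl; apply/weyl_idealP/weyl_repr_pi.
Qed.

(* The representation on F[X] with x acting as multiplication by X and y as
   d/dX; it shows that the quotient is not trivial. *)
Definition weyl_gen_act (b : bool) (p : {poly F}) : {poly F} :=
  if b then p^`() else 'X * p.

Definition weyl_act (f : Fxy) (p : {poly F}) : {poly F} :=
  \sum_(w <- msupp f) f@_w *: foldr weyl_gen_act p w.

Lemma weyl_word_act_linear (w : seq bool) :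
  linear (fun p => foldr weyl_gen_act p w).
Proof.
elim: w => [//|b w IHw] c p q /=; rewrite IHw.
by case: b => /=; rewrite ?linearP // mulrDr scalerAr.
Qed.

Lemma weyl_actEw (d : {fset {fmonom bool}}) f p : (msupp f `<=` d)%fset ->
  weyl_act f p = \sum_(w <- d) f@_w *: foldr weyl_gen_act p w.
Proof.
move=> le; rewrite /weyl_act (big_fset_incl _ le) //= => w _ /mcoeff_outdom ->.
by rewrite scale0r.
Qed.

Lemma weyl_actU c k p :
  weyl_act << c *g k >> p = c *: foldr weyl_gen_act p k.
Proof. by rewrite (weyl_actEw _ msuppU_le) big_seq_fset1 mcoeffUU. Qed.

Lemma weyl_actB p : {morph weyl_act^~ p : f g / f - g}.
Proof.
move=> f g /=; pose d := (msupp f `|` msupp g)%fset.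
rewrite (weyl_actEw (d := d)); last exact: msuppB_le.
rewrite (weyl_actEw (f := f) (d := d)) ?fsubsetUl //.
rewrite (weyl_actEw (f := g) (d := d)) ?fsubsetUr //.
by rewrite -sumrB; apply: eq_bigr => w _; rewrite mcoeffB scalerBl.
Qed.

Lemma weyl_act_sum T (s : seq T) (G : T -> Fxy) p :
  weyl_act (\sum_(t <- s) G t) p = \sum_(t <- s) weyl_act (G t) p.
Proof.
have act0 : weyl_act 0 p = 0 by rewrite -(subrr 0) weyl_actB subrr.
have actD : {morph weyl_act^~ p : f g / f + g}.
  move=> f g; rewrite -[in LHS](opprK g) weyl_actB -(sub0r g).
  by rewrite weyl_actB act0 sub0r opprK.
exact: (big_morph _ actD act0).
Qed.

Lemma weyl_act_linear f : linear (weyl_act f).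
Proof.
move=> c p q; rewrite /weyl_act scaler_sumr -big_split /=.
by apply: eq_bigr => w _; rewrite weyl_word_act_linear scalerDr !scalerA (mulrC c).
Qed.

Lemma weyl_actM f g p : weyl_act (f * g) p = weyl_act f (weyl_act g p).
Proof.
have act_sumr (T : Type) (s : seq T) (G : T -> {poly F}) (w : seq bool) :
    foldr weyl_gen_act (\sum_(t <- s) G t) w =
    \sum_(t <- s) foldr weyl_gen_act (G t) w.
  apply: (big_morph (fun q => foldr weyl_gen_act q w)) => [q r|].
    by have := weyl_word_act_linear w 1 q r; rewrite !scale1r.
  by have := weyl_word_act_linear w (-1) 0 0; rewrite !scaleN1r !addNr.
have actZ (w : seq bool) c q :
    foldr weyl_gen_act (c *: q) w = c *: foldr weyl_gen_act q w.
  have w0 : foldr weyl_gen_act 0 w = 0.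
    by have := weyl_word_act_linear w (-1) 0 0; rewrite !scaleN1r !addNr.
  by have := weyl_word_act_linear w c q 0; rewrite w0 !addr0.
rewrite malgME weyl_act_sum [RHS]/weyl_act; apply: eq_bigr => k1 _.
rewrite weyl_act_sum /weyl_act act_sumr scaler_sumr; apply: eq_bigr => k2 _.
by rewrite -/(weyl_act _ _) weyl_actU fmM foldr_cat actZ scalerA.
Qed.

Lemma weyl_act1 p : weyl_act 1 p = p.
Proof. by rewrite weyl_actU fm1 scale1r. Qed.

Lemma weyl_act_ideal f p : f \in weyl_ideal -> weyl_act f p = 0.
Proof.
have actX q : weyl_act X q = 'X * q by rewrite weyl_actU fmU scale1r.
have actY q : weyl_act Y q = q^`() by rewrite weyl_actU fmU scale1r.
have rel0 q : weyl_act (Y * X - X * Y - 1) q = 0.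
  have eYX : weyl_act (Y * X) q = ('X * q)^`() by rewrite weyl_actM actX actY.
  have eXY : weyl_act (X * Y) q = 'X * q^`() by rewrite weyl_actM actY actX.
  rewrite (weyl_actB q (Y * X - X * Y) 1) (weyl_actB q (Y * X) (X * Y)).
  rewrite [X in X - _ - _]eYX [X in _ - X - _]eXY weyl_act1.
  by rewrite derivM derivX mul1r addrK subrr.
have act0r g : weyl_act g 0 = 0.
  by have := weyl_act_linear g (-1) 0 0; rewrite !scaleN1r !addNr.
case/weyl_idealP => s Ss ->; rewrite weyl_act_sum big_seq big1 // => t ts.
by rewrite !weyl_actM (Ss t ts) rel0 act0r.
Qed.

Fact weyl_oner_neq0 : weyl_pi 1 != 0.
Proof.
rewrite -(raddf0 weyl_pi); apply/eqP => /weyl_piP; rewrite subr0.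
move=> /(weyl_act_ideal 1); rewrite weyl_act1; exact/eqP/oner_neq0.
Qed.

Fact weyl_mulA : associative weyl_mul.
Proof.
elim/weyl_ind=> f; elim/weyl_ind=> g; elim/weyl_ind=> h.
by rewrite !weyl_piM mulrA.
Qed.

Fact weyl_mul1r : left_id (weyl_pi 1) weyl_mul.
Proof. by elim/weyl_ind=> f; rewrite weyl_piM mul1r. Qed.

Fact weyl_mulr1 : right_id (weyl_pi 1) weyl_mul.
Proof. by elim/weyl_ind=> f; rewrite weyl_piM mulr1. Qed.

Fact weyl_mulDl : left_distributive weyl_mul +%R.
Proof.
elim/weyl_ind=> f; elim/weyl_ind=> g; elim/weyl_ind=> h.
by rewrite -raddfD !weyl_piM -raddfD -mulrDl.
Qed.

Fact weyl_mulDr : right_distributive weyl_mul +%R.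
Proof.
elim/weyl_ind=> f; elim/weyl_ind=> g; elim/weyl_ind=> h.
by rewrite -raddfD !weyl_piM -raddfD -mulrDr.
Qed.

HB.instance Definition _ := GRing.Zmodule_isNzRing.Build weyl
  weyl_mulA weyl_mul1r weyl_mulr1 weyl_mulDl weyl_mulDr weyl_oner_neq0.

Fact weyl_scaleA a b u :
  weyl_scale a (weyl_scale b u) = weyl_scale (a * b) u.
Proof. by elim/weyl_ind: u => f; rewrite !weyl_piZ scalerA. Qed.

Fact weyl_scale1 : left_id 1 weyl_scale.
Proof. by elim/weyl_ind=> f; rewrite weyl_piZ scale1r. Qed.

Fact weyl_scaleDr : right_distributive weyl_scale +%R.
Proof.
move=> c; elim/weyl_ind=> f; elim/weyl_ind=> g.
by rewrite -raddfD !weyl_piZ -raddfD -scalerDr.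
Qed.

Fact weyl_scaleDl u : {morph weyl_scale^~ u : a b / a + b}.
Proof.
by move=> a b; elim/weyl_ind: u => f; rewrite !weyl_piZ -raddfD -scalerDl.
Qed.

HB.instance Definition _ := GRing.Zmodule_isLmodule.Build F weyl
  weyl_scaleA weyl_scale1 weyl_scaleDr weyl_scaleDl.

Fact weyl_scaleAl (c : F) (u v : weyl) : c *: (u * v) = (c *: u) * v.
Proof.
elim/weyl_ind: u => f; elim/weyl_ind: v => g; rewrite /*:%R /*%R /=.
by rewrite weyl_piM !weyl_piZ weyl_piM -scalerAl.
Qed.

HB.instance Definition _ := GRing.Lmodule_isLalgebra.Build F weyl weyl_scaleAl.

Fact weyl_scaleAr (c : F) (u v : weyl) : c *: (u * v) = u * (c *: v).
Proof.
elim/weyl_ind: u => f; elim/weyl_ind: v => g; rewrite /*:%R /*%R /=.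
by rewrite weyl_piM !weyl_piZ weyl_piM -scalerAr.
Qed.

HB.instance Definition _ :=
  GRing.Lalgebra_isAlgebra.Build F weyl weyl_scaleAr.

Fact weyl_pi_monoid_morphism : monoid_morphism weyl_pi.
Proof. by split=> [|f g]; [|exact: esym (weyl_piM f g)]. Qed.

HB.instance Definition _ :=
  GRing.isMonoidMorphism.Build Fxy weyl weyl_pi weyl_pi_monoid_morphism.

Fact weyl_pi_scalable : scalable weyl_pi.
Proof. by move=> c f; rewrite -weyl_piZ. Qed.

HB.instance Definition _ :=
  GRing.isScalable.Build F Fxy weyl *:%R weyl_pi weyl_pi_scalable.

Definition weyl_x : weyl := weyl_pi X.
Definition weyl_y : weyl := weyl_pi Y.

Lemma weyl_rel : weyl_y * weyl_x - weyl_x * weyl_y = 1.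
Proof.
rewrite -!rmorphM -rmorphB -(rmorph1 weyl_pi); apply/weyl_piP/weyl_idealP.
exact: ideal_gen_incl.
Qed.

Definition weyl_V : set weyl := linspan [set weyl_x; weyl_y].

End Weyl.

Arguments weyl_V : clear implicits.

(* The free generators x_1, x_2, ... are [fvar F 0], [fvar F 1], ...; only
   finitely many values of v matter for a given f. *)
Definition weak_identity (F : fieldType) (A : algType F) (V : set A)
    (f : freealg F nat) : Prop :=
  forall v : nat -> A, (forall i, V (v i)) -> feval v f = 0.

Definition L_ideal (F : fieldType) (S : set (freealg F nat)) :
    set (freealg F nat) :=
  ideal_gen [set h | exists f, exists g : nat -> freealg F nat,
    [/\ S f, forall i, linspan (range (@fvar F nat)) (g i) & h = feval g f]].

Section Polynomials.
Variable R : pzRingType.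
Implicit Types a b c d : R.

Definition lie a b : R := a * b - b * a.

Definition Gamma3 a b c : R := lie (lie a b) c.

Definition St3 a b c : R := a * lie b c - b * lie a c + c * lie a b.

Definition T4 a b c d : R :=
  lie a b * lie c d - lie a c * lie b d + lie b c * lie a d.

End Polynomials.

Definition weyl_L_ideal (F : fieldType) : set (freealg F nat) :=
  let x := @fvar F nat in
  L_ideal [set Gamma3 (x 0) (x 1) (x 2);
               St3 (x 0) (x 1) (x 2);
               T4 (x 0) (x 1) (x 2) (x 3)].

Arguments weyl_L_ideal : clear implicits.

(* Main.v *)
Require Import Defs.
From mathcomp Require Import all_boot all_order all_algebra finmap.
From mathcomp Require Import boolp classical_sets cardinality.
From mathcomp Require Import monalg.
From mathcomp Require Import zify ring.

(** The argument is the classical straightening law for brackets.  Let N exceed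
    every letter index of f, and read a letter x_i as the bracket (i, N) and a
    commutator [x_i, x_j], for i < j < N, as the bracket (i, j).  Modulo the
    ideal generated by the values of Gamma3, St3 and T4 on letters, commutators
    are central, and St3 (when one bracket is a letter) and T4 (when none is)
    are one and the same Pluecker relation
      (i, j) (k, l) = (i, l) (k, j) - (i, k) (l, j).
    A product of brackets that is not standard, meaning that some bracket is
    followed by one that does not dominate it componentwise, is rewritten by
    commuting two neighbours or by the Pluecker relation ([exchange]); each
    rewriting lowers a weighted sum of the entries, so every element is
    congruent to a combination h of standard products ([tableau_straightens]).

    It remains to see that a combination h of distinct standard products that
    is a weak identity has zero coefficients ([standard_independent]).  Send x_i
    to a_i x - c_i y and let the result act on the polynomial 1, with x acting
    as multiplication by X and y as d/dX.  A commutator acts as the scalar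
    a_i c_j - a_j c_i, and a product with q letters gives a polynomial of degree
    at most q, whose coefficient at X^q is the product of these minors and of
    the a_k.  With a_i = t^(D^i) and c_i = t^(D^(N + i)) this coefficient is a
    monic polynomial in t whose degree records, as digits in base D, how often
    each index occurs in each row of the tableau.  The two rows of a standard
    tableau are sorted, hence determined by these multiplicities, so among the
    products with a given q the degrees in t are distinct.  As F is infinite,
    polynomials in t may be compared, and the term with largest q and then
    largest degree cannot cancel. *)

Set Implicit Arguments.
Unset Strict Implicit.
Unset Printing Implicit Defensive.
Import GRing.Theory.
Local Open Scope classical_set_scope.

(** * Evaluation in the free algebra *)

Section Evaluation.
Local Open Scope ring_scope.
Variables (F : fieldType) (I : choiceType) (A : algType F) (v : I -> A).

Lemma fevalU c (k : {fmonom I}) :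
  feval v << c *g k >> = c *: \prod_(i <- k) v i.
Proof. by rewrite /feval mmapU; exact: mulr_algl. Qed.

Lemma feval1 : feval v 1 = 1.
Proof. by rewrite fevalU fm1 big_nil scale1r. Qed.

Lemma feval_fvar i : feval v (fvar F i) = v i.
Proof. by rewrite fevalU scale1r fmU big_seq1. Qed.

Lemma fevalB : {morph feval v : f g / f - g}.
Proof. exact: raddfB. Qed.

Lemma feval_sum T (r : seq T) (G : T -> freealg F I) :
  feval v (\sum_(t <- r) G t) = \sum_(t <- r) feval v (G t).
Proof. exact: raddf_sum. Qed.

Lemma fevalZ k f : feval v (k *: f) = k *: feval v f.
Proof.
rewrite {1}[f]monalgE scaler_sumr feval_sum [feval v f]mmapE scaler_sumr.
apply: eq_bigr => w _.
have -> : k *: << f@_w *g w >> = << (k * f@_w) *g w >>.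
  by apply/malgP => m; rewrite mcoeffZ !mcoeffU mulrnAr.
by rewrite fevalU mulr_algl scalerA.
Qed.

Lemma fevalM : {morph feval v : f g / f * g}.
Proof.
move=> f g; rewrite malgME feval_sum [feval v f]/feval mmapE mulr_suml.
apply: eq_bigr => k _; rewrite feval_sum [feval v g]/feval mmapE mulr_sumr.
apply: eq_bigr => l _; rewrite fevalU fmM big_cat /=.
by rewrite !mulr_algl -scalerAl -scalerAr scalerA.
Qed.

Lemma freealg_wordE (f : freealg F I) :
  f = \sum_(w <- msupp f) f@_w *: \prod_(i <- w) fvar F i.
Proof.
rewrite [LHS]monalgE; apply: eq_bigr => w _.
have -> : \prod_(i <- w) fvar F i = << w >>.
  case: w => w; elim: w => [|i w IHw] /=.
    by rewrite big_nil; congr << _ *g _ >>; apply: val_inj; rewrite /= fm1.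
  rewrite big_cons {}IHw malgM_def fgmulUU mulr1; congr << _ *g _ >>.
  by apply: val_inj; rewrite /= fmM fmU.
by apply/malgP => k; rewrite mcoeffZ !mcoeffU mulrnAr mulr1.
Qed.

End Evaluation.

Section Naturality.
Local Open Scope ring_scope.

Lemma lrmorph_feval (F : fieldType) (I : choiceType) (A B : algType F)
    (h : {lrmorphism A -> B}) (v : I -> A) (f : freealg F I) :
  h (feval v f) = feval (h \o v) f.
Proof.
rewrite /feval !mmapE raddf_sum; apply: eq_bigr => w _ /=.
by rewrite !mulr_algl linearZ /= rmorph_prod.
Qed.
End Naturality.

(** * Straightening modulo the three relations *)

Section MapRelations.
Local Open Scope ring_scope.
Variables (R S : pzRingType) (h : R -> S).
Hypotheses (hB : {morph h : u v / u - v}) (hM : {morph h : u v / u * v}).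

Lemma map_lie a b : h (lie a b) = lie (h a) (h b).
Proof. by rewrite /lie hB !hM. Qed.

Let hD : {morph h : u v / u + v}.
Proof.
have h0 : h 0 = 0 by rewrite -(subrr 0) hB subrr.
have hN u : h (- u) = - h u by rewrite -sub0r hB h0 sub0r.
by move=> u v; rewrite -[in LHS](opprK v) hB hN opprK.
Qed.

Lemma map_Gamma3 a b c : h (Gamma3 a b c) = Gamma3 (h a) (h b) (h c).
Proof. by rewrite /Gamma3 !map_lie. Qed.

Lemma map_St3 a b c : h (St3 a b c) = St3 (h a) (h b) (h c).
Proof. by rewrite /St3 hD hB !hM !map_lie. Qed.

Lemma map_T4 a b c d : h (T4 a b c d) = T4 (h a) (h b) (h c) (h d).
Proof. by rewrite /T4 hD hB !hM !map_lie. Qed.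

End MapRelations.

Section Straightening.
Local Open Scope ring_scope.
Variables (F : fieldType) (A : algType F) (x : nat -> A).
Implicit Types (f g h : A) (b : nat * nat) (s u : seq (nat * nat)).

(** Letters suffice as arguments: these values already lie in the L-ideal, and
    they are all that straightening uses. *)
Inductive basic_relation : set A :=
| BasicGamma3 i j k : basic_relation (Gamma3 (x i) (x j) (x k))
| BasicSt3 i j k : basic_relation (St3 (x i) (x j) (x k))
| BasicT4 i j k l : basic_relation (T4 (x i) (x j) (x k) (x l)).

Definition cong f g := ideal_gen basic_relation (f - g).

Lemma cong_refl f : cong f f.
Proof. by rewrite /cong subrr; exact: ideal_gen0. Qed.

Lemma cong_sym f g : cong f g -> cong g f.
Proof.
move=> fg; rewrite /cong -opprB -[- _]add0r.
by apply: ideal_genB => //; exact: ideal_gen0.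
Qed.

Lemma cong_trans g f h : cong f g -> cong g h -> cong f h.
Proof. by move=> fg gh; rewrite /cong -(subrKA g); exact: ideal_genD. Qed.

Lemma congD f f' g g' : cong f f' -> cong g g' -> cong (f + g) (f' + g').
Proof. by rewrite /cong opprD addrACA; exact: ideal_genD. Qed.

Lemma congN f f' : cong f f' -> cong (- f) (- f').
Proof. by move=> /cong_sym; rewrite /cong opprK addrC. Qed.

Lemma congB f f' g g' : cong f f' -> cong g g' -> cong (f - g) (f' - g').
Proof. by move=> ff' gg'; apply: congD => //; exact: congN. Qed.

Lemma congM f f' g g' : cong f f' -> cong g g' -> cong (f * g) (f' * g').
Proof. exact: ideal_gen_mulB. Qed.

Lemma congZ c f f' : cong f f' -> cong (c *: f) (c *: f').
Proof. by rewrite /cong -scalerBr -mulr_algl; exact: ideal_genMl. Qed.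

Lemma cong_sum (T : Type) (r : seq T) (G H : T -> A) :
  (forall t, cong (G t) (H t)) -> cong (\sum_(t <- r) G t) (\sum_(t <- r) H t).
Proof. by move=> GH; apply: big_ind2 => //; [exact: cong_refl|exact: congD]. Qed.

(** The extra index N stands for a vector adjoined to the letters, so that the
    letters become brackets too and St3 becomes a case of T4. *)
Definition bracket N b : A :=
  if b.2 == N then x b.1 else lie (x b.1) (x b.2).

Definition tableau_monomial N s : A := \prod_(b <- s) bracket N b.

Lemma lie_letter_cong i j k :
  cong (lie (x i) (x j) * x k) (x k * lie (x i) (x j)).
Proof. exact/ideal_gen_incl/BasicGamma3. Qed.

Lemma central_bracket_cong z : (forall k, cong (z * x k) (x k * z)) ->
  forall N b, cong (z * bracket N b) (bracket N b * z).
Proof.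
move=> zC N b; have zC2 k l : cong (z * (x k * x l)) (x k * x l * z).
  rewrite mulrA; apply: (@cong_trans (x k * z * x l)).
    exact: congM (zC _) (cong_refl _).
  by rewrite -!mulrA; exact: congM (cong_refl _) (zC _).
rewrite /bracket; case: ifP => _; first exact: zC.
by rewrite /lie mulrBr mulrBl; exact: congB.
Qed.

Lemma bracketC_cong N b b' : (b.2 != N) || (b'.2 != N) ->
  cong (bracket N b * bracket N b') (bracket N b' * bracket N b).
Proof.
case/orP => /negPf neqN.
  rewrite {1 4}/bracket neqN; apply: central_bracket_cong => k.
  exact: lie_letter_cong.
apply: cong_sym; rewrite {1 4}/bracket neqN.
by apply: central_bracket_cong => k; exact: lie_letter_cong.
Qed.

(** For j = N this is St3, and otherwise it is T4; in both cases centrality of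
    commutators puts the factors in the stated order. *)
Lemma plucker_cong N i k l j : (k < N)%N -> (l < N)%N ->
  cong (bracket N (i, j) * bracket N (k, l))
       (bracket N (i, l) * bracket N (k, j)
        - bracket N (i, k) * bracket N (l, j)).
Proof.
move=> /ltn_eqF kN /ltn_eqF lN; have [jN|jN] := eqVneq j N.
  apply: (@cong_trans
    (bracket N (k, j) * bracket N (i, l) - bracket N (l, j) * bracket N (i, k))).
    apply: ideal_gen_incl; rewrite /bracket /= kN lN jN eqxx.
    by rewrite opprB addrCA addrC; exact: BasicSt3.
  by apply: congB; apply: bracketC_cong; rewrite /= ?kN ?lN ?orbT.
apply: (@cong_trans (bracket N (k, l) * bracket N (i, j))).
  by apply: bracketC_cong; rewrite /= jN.
apply: ideal_gen_incl; rewrite /bracket /= kN lN (negPf jN).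
by rewrite opprB addrC; exact: BasicT4.
Qed.

Definition valid N s := all (fun b => b.1 < b.2 <= N)%N s.

(** Sorting for this partial order makes both rows of the tableau weakly
    increasing, the letters coming last because N is the largest index. *)
Definition dominates b b' := ((b.1 <= b'.1) && (b.2 <= b'.2))%N.

Definition standard N s := valid N s && sorted dominates s.

Definition height b := (b.1 + b.2)%N.
Definition total_height s := (\sum_(b <- s) height b)%N.
(** A sum in which earlier brackets weigh more.  It strictly decreases in every
    rewriting used below, since the first of the two new brackets always has a
    smaller sum of entries than the first of the two old ones. *)
Fixpoint disorder s : nat :=
  if s is b :: s' then size s * height b + disorder s' else 0.

Lemma disorder_cat s u :
  disorder (s ++ u) = (disorder s + size u * total_height s + disorder u)%N.
Proof.
elim: s => [|b s IHs] /=; first by rewrite /total_height big_nil muln0.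
by rewrite IHs /total_height !big_cons size_cat; lia.
Qed.

(** The two extra inequalities make the decrease of [disorder] stable under
    adding brackets on both sides. *)
Definition exchange_smaller u' u :=
  [&& size u' <= size u, total_height u' <= total_height u
    & disorder u' < disorder u]%N.

Lemma exchange_smaller_cat s u u' v : exchange_smaller u' u ->
  (disorder (s ++ u' ++ v) < disorder (s ++ u ++ v))%N.
Proof.
case/and3P => size_le height_le lt; rewrite !disorder_cat !size_cat.
have := leq_mul size_le (leqnn (total_height s)).
have := leq_mul (leqnn (size v)) height_le.
by rewrite !mulnDl; lia.
Qed.

Lemma tableau_monomial_cat N s u :
  tableau_monomial N (s ++ u) = tableau_monomial N s * tableau_monomial N u.
Proof. exact: big_cat. Qed.

Lemma tableau_monomial2 N b b' :
  tableau_monomial N [:: b; b'] = bracket N b * bracket N b'.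
Proof. by rewrite /tableau_monomial !big_cons big_nil mulr1. Qed.

(** Two neighbours in the wrong order are either comparable, and are swapped, or
    nested one inside the other, and then the Pluecker relation applies, after a
    swap if the inner one comes first.  Swapping two letters costs a commutator,
    which is a single bracket and thus lowers [disorder] as well. *)
Lemma exchange N b b' : valid N [:: b; b'] -> ~~ dominates b b' ->
  exists2 r : seq (F * seq (nat * nat)),
    all (fun t => valid N t.2 && exchange_smaller t.2 [:: b; b']) r &
    cong (bracket N b * bracket N b')
         (\sum_(t <- r) t.1 *: tableau_monomial N t.2).
Proof.
case: b b' => [i j] [k l]; rewrite /valid /= andbT.
case/andP=> /andP[ij jN] /andP[kl lN].
rewrite /dominates /= negb_and -!ltnNge => not_dom.
have [/andP[ki lj]|] := boolP ((k <= i) && (l <= j))%N.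
  have [/andP[/eqP lE /eqP jE]|nN] := boolP ((l == N) && (j == N)).
    exists [:: (1, [:: (k, l); (i, j)]); (- 1, [:: (k, i)])].
      rewrite /valid /exchange_smaller /total_height /= !big_cons.
      rewrite !big_nil /height /=.
      by lia.
    rewrite !big_cons big_nil addr0 scaleN1r scale1r tableau_monomial2.
    rewrite /tableau_monomial big_seq1 /bracket /= lE jE eqxx ltn_eqF; last lia.
    by rewrite /lie opprB addrC subrK; exact: cong_refl.
  exists [:: (1, [:: (k, l); (i, j)])].
    rewrite /valid /exchange_smaller /total_height /= !big_cons.
    rewrite !big_nil /height /=.
    by lia.
  rewrite big_seq1 scale1r tableau_monomial2; apply: bracketC_cong => /=.
  by lia.
move=> not_dom'; have [ik|ki] := ltnP i k.
  exists [:: (1, [:: (i, l); (k, j)]); (- 1, [:: (i, k); (l, j)])].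
    rewrite /valid /exchange_smaller /total_height /= !big_cons.
    rewrite !big_nil /height /=.
    by lia.
  rewrite !big_cons big_nil addr0 scaleN1r scale1r !tableau_monomial2.
  by apply: plucker_cong; lia.
exists [:: (1, [:: (k, j); (i, l)]); (- 1, [:: (k, i); (j, l)])].
  rewrite /valid /exchange_smaller /total_height /= !big_cons.
  rewrite !big_nil /height /=.
  by lia.
rewrite !big_cons big_nil addr0 scaleN1r scale1r !tableau_monomial2.
apply: (@cong_trans (bracket N (k, l) * bracket N (i, j))).
  by apply: bracketC_cong => /=; lia.
by apply: plucker_cong; lia.
Qed.

Definition straightens N f := exists2 r : seq (F * seq (nat * nat)),
  all (fun t => standard N t.2) r &
  cong f (\sum_(t <- r) t.1 *: tableau_monomial N t.2).

Lemma straightens_cong N f g : cong f g -> straightens N g -> straightens N f.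
Proof. by move=> fg [r rs gr]; exists r => //; exact: cong_trans fg gr. Qed.

Lemma straightens0 N : straightens N 0.
Proof. by exists [::] => //; rewrite big_nil; exact: cong_refl. Qed.

Lemma straightensD N f g :
  straightens N f -> straightens N g -> straightens N (f + g).
Proof.
move=> [r rs fr] [q qs gq]; exists (r ++ q); first by rewrite all_cat rs.
by rewrite big_cat; exact: congD.
Qed.

Lemma straightensZ N c f : straightens N f -> straightens N (c *: f).
Proof.
move=> [r rs fr]; exists [seq (c * t.1, t.2) | t <- r]; first by rewrite all_map.
rewrite big_map; under eq_bigr do rewrite -scalerA.
by rewrite -scaler_sumr; exact: congZ.
Qed.

Lemma straightens_sum N (T : eqType) (r : seq T) (c : T -> F) (G : T -> A) :
  {in r, forall t, straightens N (G t)} ->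
  straightens N (\sum_(t <- r) c t *: G t).
Proof.
elim: r => [|t r IHr] Gr; first by rewrite big_nil; exact: straightens0.
rewrite big_cons; apply: straightensD; first by apply/straightensZ/Gr/mem_head.
by apply: IHr => u ur; apply: Gr; rewrite inE ur orbT.
Qed.

Lemma not_sortedP (T : Type) (e : rel T) (p : seq T) : ~~ sorted e p ->
  exists p1 t t' p2, p = p1 ++ [:: t; t'] ++ p2 /\ ~~ e t t'.
Proof.
case: p => // t p; elim: p t => //= t' p IHp t.
have [tt' /IHp[p1 [w [w' [p2 [-> nw]]]]]|ntt' _] := boolP (e t t').
  by exists (t :: p1), w, w', p2.
by exists [::], t, t', p.
Qed.

Lemma tableau_straightens N s :
  valid N s -> straightens N (tableau_monomial N s).
Proof.
have [n] := ubnP (disorder s); elim: n s => // n IHn s s_lt s_valid.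
have [s_sorted|/not_sortedP] := boolP (sorted dominates s).
  exists [:: (1, s)]; first by rewrite /= /standard s_valid s_sorted.
  by rewrite big_seq1 scale1r; exact: cong_refl.
case=> [s1 [b [b' [s2 [sE ndom]]]]]; rewrite {s}sE in s_lt s_valid *.
move: s_valid; rewrite /valid !all_cat => /and3P[v1 vb v2].
have [r rP br] := exchange vb ndom.
apply: (@straightens_cong _ _
  (\sum_(t <- r) t.1 *: tableau_monomial N (s1 ++ t.2 ++ s2))).
  rewrite !tableau_monomial_cat tableau_monomial2.
  apply: (@cong_trans (tableau_monomial N s1 *
    ((\sum_(t <- r) t.1 *: tableau_monomial N t.2) * tableau_monomial N s2))).
    by apply: congM (cong_refl _) (congM br (cong_refl _)).
  rewrite mulr_suml mulr_sumr; apply: cong_sum => t.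
  by rewrite !tableau_monomial_cat -scalerAl -scalerAr; exact: cong_refl.
apply: straightens_sum => t /(allP rP)/andP[vt lt]; apply: IHn.
  by apply: leq_trans (exchange_smaller_cat _ _ lt) _; rewrite -ltnS.
by rewrite /valid !all_cat v1 v2 andbT.
Qed.

End Straightening.

(** * The free algebra and the L-ideal *)

Section FreeAlgebra.
Local Open Scope ring_scope.
Variable F : fieldType.
Implicit Types f : freealg F nat.

Lemma basic_relation_L_ideal f :
  ideal_gen (basic_relation (@fvar F nat)) f -> weyl_L_ideal F f.
Proof.
set x := @fvar F nat; move=> [s Ss ->]; exists s => // t /Ss t_rel.
pose xs4 (i j k l n : nat) := x (nth i [:: i; j; k; l] n).
have xs4P i j k l n : linspan (range x) (xs4 i j k l n).
  exists [:: (1, xs4 i j k l n)]; last by rewrite big_seq1 scale1r.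
  by move=> y; rewrite inE => /eqP ->; exists (nth i [:: i; j; k; l] n).
have ev i j k l := @feval_fvar F nat (freealg F nat) (xs4 i j k l).
have evB i j k l := @fevalB F nat (freealg F nat) (xs4 i j k l).
have evM i j k l := @fevalM F nat (freealg F nat) (xs4 i j k l).
case: t_rel => [i j k|i j k|i j k l].
- exists (Gamma3 (x 0) (x 1) (x 2)), (xs4 i j k 0%N); split=> //.
    by left; left.
  by rewrite (map_Gamma3 (evB i j k 0%N) (evM i j k 0%N)) !ev.
- exists (St3 (x 0) (x 1) (x 2)), (xs4 i j k 0%N); split=> //.
    by left; right.
  by rewrite (map_St3 (evB i j k 0%N) (evM i j k 0%N)) !ev.
- exists (T4 (x 0) (x 1) (x 2) (x 3)), (xs4 i j k l); split=> //.
    by right.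
  by rewrite (map_T4 (evB i j k l) (evM i j k l)) !ev.
Qed.

(** A word is a product of brackets that are all letters. *)
Lemma freealg_straightens f : exists N, straightens (@fvar F nat) N f.
Proof.
pose N := (\max_(w <- msupp f) \max_(i <- w) i).+1; exists N.
rewrite [f]freealg_wordE; apply: straightens_sum => w w_f.
have -> : \prod_(i <- w) fvar F i =
    tableau_monomial (@fvar F nat) N [seq (i, N) | i <- w].
  rewrite /tableau_monomial big_map; apply: eq_bigr => i _.
  by rewrite /bracket /= eqxx.
apply: tableau_straightens; rewrite /valid all_map; apply/allP => i iw /=.
rewrite leqnn andbT ltnS; apply: (@leq_trans (\max_(i <- w) i)).
  exact: leq_bigmax_seq.
exact: (@leq_bigmax_seq _ _ predT (fun w : {fmonom nat} => \max_(i <- w) i)%N).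
Qed.

End FreeAlgebra.

(** * Standard tableaux are determined by their content *)

Section StandardTableaux.
Implicit Types (b : nat * nat) (s : seq (nat * nat)) (u v : seq nat).

Lemma sum_digits_inj D n (c d : nat -> nat) :
  (forall i, c i < D) -> (forall i, d i < D) ->
  \sum_(i < n) c i * D ^ i = \sum_(i < n) d i * D ^ i ->
  forall i, i < n -> c i = d i.
Proof.
elim: n c d => // n IHn c d cD dD.
have shift (e : nat -> nat) :
    \sum_(i < n.+1) e i * D ^ i = (\sum_(i < n) e i.+1 * D ^ i) * D + e 0.
  rewrite big_ord_recl expn0 muln1 addnC big_distrl /=; congr (_ + _).
  by apply: eq_bigr => i _; rewrite /bump /= add1n expnSr mulnA.
rewrite !shift => eq_cd.
have c0 : c 0 = d 0.
  by have := congr1 (modn^~ D) eq_cd; rewrite !modnMDl !modn_small.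
have /eqP := eq_cd; rewrite c0 eqn_add2r eqn_pmul2r; last by have := cD 0; lia.
move=> /eqP /(IHn (c \o succn) (d \o succn)) IH [|i] //.
by rewrite ltnS => /IH; apply => j /=.
Qed.

Lemma sum_powers_count D n u : all (fun i => i < n) u ->
  \sum_(i <- u) D ^ i = \sum_(i < n) count_mem (i : nat) u * D ^ i.
Proof.
elim: u => [|k u IHu] /=; first by rewrite big_nil big1.
case/andP=> kn /IHu {}IHu; rewrite big_cons IHu.
under [RHS]eq_bigr do rewrite mulnDl.
rewrite big_split /=; congr (_ + _).
rewrite (bigD1 (Ordinal kn)) //= eqxx mul1n big1 ?addn0 // => i.
by rewrite -val_eqE /= eq_sym => /negPf ->.
Qed.

Lemma sum_powers_inj D u v : size u < D -> size v < D ->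
  \sum_(i <- u) D ^ i = \sum_(i <- v) D ^ i -> perm_eq u v.
Proof.
move=> uD vD eq_uv; pose n := (\max_(i <- u ++ v) i).+1.
have lt_n i : i \in u ++ v -> i < n by move=> iuv; rewrite ltnS leq_bigmax_seq.
have un : all (fun i => i < n) u.
  by apply/allP => i iu; rewrite lt_n // mem_cat iu.
have vn : all (fun i => i < n) v.
  by apply/allP => i iv; rewrite lt_n // mem_cat iv orbT.
move: eq_uv; rewrite (sum_powers_count _ un) (sum_powers_count _ vn).
pose count_in (w : seq nat) i := count_mem i w.
move/(@sum_digits_inj D n (count_in u) (count_in v)) => eq_c.
apply/allP => i iuv; apply/eqP; apply: eq_c (lt_n i iuv) => j.
  exact: leq_ltn_trans (count_size _ _) uD.
exact: leq_ltn_trans (count_size _ _) vD.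
Qed.

(** In base D, this number lists the multiplicities of the entries of the top
    row in the digits below N and those of the bottom row in the digits from N
    on. *)
Definition weight D N s := \sum_(b <- s) (D ^ b.1 + D ^ (N + b.2)).

(** The digits give the content of each row, and both rows are sorted.  Entries
    of the top row are smaller than N, which separates the two rows. *)
Lemma weight_inj D N s1 s2 : (size s1).*2 < D -> (size s2).*2 < D ->
  standard N s1 -> standard N s2 -> weight D N s1 = weight D N s2 -> s1 = s2.
Proof.
pose rows s := [seq b.1 | b <- s] ++ [seq N + b.2 | b <- s].
have weightE s : weight D N s = \sum_(i <- rows s) D ^ i.
  by rewrite /weight big_split big_cat !big_map.
have size_rows s : size (rows s) = (size s).*2.
  by rewrite size_cat !size_map addnn.
move=> s1D s2D /andP[v1 o1] /andP[v2 o2]; rewrite !weightE.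
move/sum_powers_inj; rewrite !size_rows => /(_ s1D s2D) eq_rows.
have top s : valid N s -> [seq i <- rows s | i < N] = [seq b.1 | b <- s].
  move=> /allP vs; rewrite filter_cat (eq_in_filter (a2 := predT)) ?filter_predT.
    rewrite [X in _ ++ X](eq_in_filter (a2 := pred0)) ?filter_pred0 ?cats0 //.
    by move=> _ /mapP[b _ ->] /=; lia.
  by move=> _ /mapP[b /vs/andP[b12 b2N] ->] /=; lia.
have bot s : valid N s -> [seq i <- rows s | ~~ (i < N)] = [seq N + b.2 | b <- s].
  move=> /allP vs; rewrite filter_cat (eq_in_filter (a2 := pred0)) ?filter_pred0.
    rewrite cat0s (eq_in_filter (a2 := predT)) ?filter_predT //.
    by move=> _ /mapP[b _ ->] /=; lia.
  by move=> _ /mapP[b /vs/andP[b12 b2N] ->] /=; lia.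
have sorted_row (h : nat * nat -> nat) s :
    (forall b b', dominates b b' -> h b <= h b') ->
    sorted dominates s -> sorted leq (map h s).
  by move=> h_homo; exact: (homo_sorted (e := dominates)).
have row_eq (h : nat * nat -> nat) (p : pred nat) :
    (forall b b', dominates b b' -> h b <= h b') ->
    (forall s, valid N s -> [seq i <- rows s | p i] = map h s) ->
    map h s1 = map h s2.
  move=> h_homo pE; apply: (sorted_eq leq_trans anti_leq).
  - exact: sorted_row.
  - exact: sorted_row.
  by rewrite -!pE //; exact: perm_filter.
have eq1 := row_eq _ _ (fun b b' (h : dominates b b') => (andP h).1) top.
have eq2 : [seq N + b.2 | b <- s1] = [seq N + b.2 | b <- s2].
  by apply: row_eq bot => b b' /andP[_]; rewrite leq_add2l.
have {}eq2 : unzip2 s1 = unzip2 s2.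
  apply: (inj_map (@addnI N)); rewrite -!map_comp.
  exact: eq2.
by rewrite -[s1]zip_unzip -[s2]zip_unzip eq2; congr zip.
Qed.

Definition singles N s := count (fun b => b.2 == N) s.

(** The contribution of a bracket to [weight], except that the top digit, which
    counts the letters, is left out: it is recorded by the degree in X. *)
Definition bracket_degree D N b :=
  D ^ b.1 + (if b.2 == N then 0 else D ^ (N + b.2)).

Lemma weightE D N s :
  weight D N s = \sum_(b <- s) bracket_degree D N b + singles N s * D ^ (N + N).
Proof.
elim: s => [|b s IHs]; first by rewrite /weight !big_nil.
rewrite /weight !big_cons -/(weight D N s) IHs /singles /bracket_degree /=.
by case: eqVneq => [->|_] /=; lia.
Qed.

End StandardTableaux.

(** * The action on polynomials *)

Section LeadingPolynomials.
Local Open Scope ring_scope.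
Variables (F : fieldType) (D N : nat).
Hypothesis D_gt1 : (1 < D)%N.
Implicit Types (b : nat * nat) (s : seq (nat * nat)).

(** The minor a_i c_j - a_j c_i, or the coordinate a_i when j = N, at
    a_i = t^(D^i) and c_i = t^(D^(N + i)). *)
Definition bracket_poly b : {poly F} :=
  if b.2 == N then 'X^(D ^ b.1)
  else 'X^(D ^ b.1 + D ^ (N + b.2)) - 'X^(D ^ b.2 + D ^ (N + b.1)).

Definition tableau_poly s : {poly F} := \prod_(b <- s) bracket_poly b.

(** Passing from a_j c_i to a_i c_j lowers the degree by D^j - D^i through a, but
    raises it by D^N times as much through c. *)
Lemma bracket_poly_monic b : (b.1 < b.2 <= N)%N ->
  (bracket_poly b \is monic) /\ size (bracket_poly b) = (bracket_degree D N b).+1.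
Proof.
case: b => i j /= /andP[ij jN]; rewrite /bracket_poly /bracket_degree /=.
case: ifP => _; first by rewrite monicXn size_polyXn addn0.
have lt : (size (- 'X^(D ^ j + D ^ (N + i)) : {poly F})
           < size ('X^(D ^ i + D ^ (N + j)) : {poly F}))%N.
  rewrite size_polyN !size_polyXn ltnS !expnD.
  have Dij : (D ^ i < D ^ j)%N by rewrite ltn_exp2l.
  have DN : (D ^ 1 <= D ^ N)%N by rewrite leq_exp2l //; lia.
  by rewrite expn1 in DN; nia.
split; last by rewrite size_polyDl // size_polyXn.
by rewrite monicE lead_coefDl // lead_coefXn.
Qed.

Lemma tableau_poly_monic s : valid N s -> (tableau_poly s \is monic) /\
  size (tableau_poly s) = (\sum_(b <- s) bracket_degree D N b).+1.
Proof.
rewrite /tableau_poly; elim: s => [|b s IHs] /=.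
  by rewrite !big_nil monic1 size_poly1.
case/andP => /bracket_poly_monic[b_mon bE] /IHs[s_mon sE]; rewrite !big_cons.
split; first by rewrite monicMl.
by rewrite size_monicM ?monic_neq0 // bE sE addSn addnS.
Qed.

End LeadingPolynomials.

(** The computations below hold for any ring acting on polynomials in which the
    letters act as a_i X - c_i d/dX; they show that Gamma3, St3 and T4 act as
    zero on letters. *)
Section DifferentialOperators.
Local Open Scope ring_scope.
Variables (F : fieldType) (R : pzRingType) (op : R -> {poly F} -> {poly F}).
Variables (x : nat -> R) (a c : nat -> F).
Hypothesis opB : forall f g p, op (f - g) p = op f p - op g p.
Hypothesis opM : forall f g p, op (f * g) p = op f (op g p).
Hypothesis op_letter : forall i p, op (x i) p = a i *: ('X * p) - c i *: p^`().

Let opD f g p : op (f + g) p = op f p + op g p.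
Proof.
have op0 : op 0 p = 0 by rewrite -(subrr 0) opB subrr.
have opN : op (- g) p = - op g p by rewrite -sub0r opB op0 sub0r.
by rewrite -[in LHS](opprK g) opB opN opprK.
Qed.

Lemma op_lie i j p : op (lie (x i) (x j)) p = (a i * c j - a j * c i) *: p.
Proof.
rewrite opB !opM !op_letter !derivB !derivZ !derivM derivX.
by rewrite -!mul_polyC !polyCB !polyCM; ring.
Qed.

Lemma op_Gamma3 i j k p : op (Gamma3 (x i) (x j) (x k)) p = 0.
Proof.
rewrite opB !opM !op_lie !op_letter derivZ.
by rewrite -!mul_polyC; ring.
Qed.

Lemma op_St3 i j k p : op (St3 (x i) (x j) (x k)) p = 0.
Proof.
rewrite opD opB !opM !op_lie !op_letter !derivZ.
by rewrite -!mul_polyC !polyCB !polyCM; ring.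
Qed.

Lemma op_T4 i j k l p : op (T4 (x i) (x j) (x k) (x l)) p = 0.
Proof.
rewrite opD opB !opM !op_lie.
by rewrite -!mul_polyC !polyCB !polyCM; ring.
Qed.

End DifferentialOperators.

Lemma linspan2B (F : fieldType) (V : lmodType F) (u w : V) (a c : F) :
  linspan [set u; w] (a *: u - c *: w)%R.
Proof.
exists [:: (a, u); (- c, w)%R].
  by move=> t; rewrite !inE => /orP[] /eqP -> /=; [left|right].
by rewrite !big_cons big_nil addr0 /= scaleNr.
Qed.

Section Action.
Local Open Scope ring_scope.
Variables (F : fieldType) (a c : nat -> F).
Implicit Types (f g : freealg F nat) (p : {poly F}).

Definition free_vector i : freealg F bool :=
  a i *: fvar F false - c i *: fvar F true.

Definition act f p : {poly F} := weyl_act (feval free_vector f) p.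

Lemma weyl_actZ k (f : freealg F bool) p :
  weyl_act (k *: f) p = k *: weyl_act f p.
Proof.
rewrite /weyl_act scaler_sumr -/(weyl_act _ _) (weyl_actEw _ (msuppZ_le k f)).
by apply: eq_bigr => w _; rewrite mcoeffZ scalerA.
Qed.

Lemma act_letter i p : act (fvar F i) p = a i *: ('X * p) - c i *: p^`().
Proof.
rewrite /act feval_fvar (weyl_actB p (a i *: fvar F false) (c i *: fvar F true)).
by congr (_ - _); rewrite weyl_actZ weyl_actU fmU scale1r.
Qed.

Lemma act1 p : act 1 p = p.
Proof. by rewrite /act feval1 weyl_act1. Qed.

Lemma actM f g p : act (f * g) p = act f (act g p).
Proof. by rewrite /act fevalM weyl_actM. Qed.

Lemma actB f g p : act (f - g) p = act f p - act g p.
Proof. by rewrite /act fevalB weyl_actB. Qed.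

Lemma act_sum T (r : seq T) (G : T -> freealg F nat) p :
  act (\sum_(t <- r) G t) p = \sum_(t <- r) act (G t) p.
Proof. by rewrite /act feval_sum weyl_act_sum. Qed.

Lemma actZ k f p : act (k *: f) p = k *: act f p.
Proof. by rewrite /act fevalZ weyl_actZ. Qed.

Lemma act_lie i j p :
  act (lie (fvar F i) (fvar F j)) p = (a i * c j - a j * c i) *: p.
Proof. exact: (op_lie actB actM act_letter). Qed.

Lemma act_relation f p : basic_relation (@fvar F nat) f -> act f p = 0.
Proof.
case=> [i j k|i j k|i j k l].
- exact: (op_Gamma3 actB actM act_letter).
- exact: (op_St3 actB actM act_letter).
- exact: (op_T4 actB actM act_letter).
Qed.

Lemma act_ideal f p : ideal_gen (basic_relation (@fvar F nat)) f -> act f p = 0.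
Proof.
case=> r rel ->; rewrite act_sum big_seq big1 // => t /rel /act_relation t0.
have act0r g : act g 0 = 0.
  have := weyl_act_linear (feval free_vector g) (-1) 0 0.
  by rewrite !scaleN1r !addNr.
by rewrite !actM t0 act0r.
Qed.

(** The values a_i x - c_i y lie in V, so f vanishes on them in the Weyl algebra,
    and the action on polynomials factors through that algebra. *)
Lemma act_weak_identity f p : weak_identity (weyl_V F) f -> act f p = 0.
Proof.
pose v i := weyl_pi (free_vector i).
have vV i : weyl_V F (v i).
  have -> : v i = a i *: weyl_x F - c i *: weyl_y F; last exact: linspan2B.
  rewrite -[a i *: weyl_x F](weyl_pi_scalable (a i) (fvar F false)).
  rewrite -[c i *: weyl_y F](weyl_pi_scalable (c i) (fvar F true)).
  exact: weyl_pi_zmod.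
move=> /(_ v vV) fv0; apply: weyl_act_ideal.
have : weyl_pi (feval free_vector f) = weyl_pi 0.
  by rewrite raddf0 -[RHS]fv0 (lrmorph_feval (@weyl_pi F : {lrmorphism _ -> _})).
by move/weyl_piP; rewrite subr0.
Qed.

End Action.

(** * Independence of the standard products *)

Lemma infinite_poly_eq0 (F : fieldType) (p : {poly F}) :
  infinite_set [set: F] -> (forall t, p.[t] = 0)%R -> p = 0%R.
Proof.
move=> F_inf p0; apply/eqP/negPn/negP => p_neq0.
have [B _ Bsize] := infinite_set_fset (size p) F_inf.
have := max_poly_roots p_neq0 _ (fset_uniq B).
have -> : all (root p) B by apply/allP => t _; apply/rootP/p0.
by move=> /(_ isT); rewrite ltnNge Bsize.
Qed.

Lemma exists_max_seq (T : eqType) (h : T -> nat) (r : seq T) (t0 : T) :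
  t0 \in r ->
  exists2 t, t \in r & {in r, forall u, h u <= h t}.
Proof.
move=> t0r; have ex : exists n, has (fun t => h t == n) r.
  by exists (h t0); apply/hasP; exists t0.
have bound n : has (fun t => h t == n) r -> n <= \max_(t <- r) h t.
  by case/hasP => t tr /eqP <-; exact: leq_bigmax_seq.
case: (ex_maxnP ex bound) => n /hasP[t tr /eqP tn] max_n.
by exists t => // u ur; rewrite tn; apply: max_n; apply/hasP; exists u.
Qed.

Section Independence.
Local Open Scope ring_scope.
Variables (F : fieldType) (D N : nat).
Hypothesis D_gt1 : (1 < D)%N.
Implicit Types (b : nat * nat) (s : seq (nat * nat)) (t : F).
Local Notation x := (@fvar F nat).

Definition power_act t : freealg F nat -> {poly F} -> {poly F} :=
  act (fun i => t ^+ (D ^ i)) (fun i => t ^+ (D ^ (N + i))).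

(** Commutators act as scalars.  In a letter, a_i X raises the degree by one,
    while the derivative lowers it and does not reach the top coefficient. *)
Lemma power_act_tableau t s : valid N s ->
  (size (power_act t (tableau_monomial x N s) 1) <= (singles N s).+1)%N /\
  (power_act t (tableau_monomial x N s) 1)`_(singles N s) =
    (tableau_poly F D N s).[t].
Proof.
rewrite /tableau_monomial /tableau_poly /singles.
elim: s => [|b s IHs] /=.
  by rewrite !big_nil [power_act _ _ _]act1 size_poly1 coef1 hornerC.
case/andP => b_valid /IHs[]; rewrite !big_cons [power_act _ (_ * _) _]actM.
rewrite -/(power_act t).
move: (power_act t _ 1) => p; rewrite hornerM.
rewrite /bracket /bracket_poly; case: (b.2 == N) => p_size p_coef /=.
  have deriv_size : (size p^`() <= size p)%N.
    by apply: leq_trans (size_poly _ _) (leq_pred _).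
  rewrite [power_act _ _ _]act_letter add1n hornerXn; split.
    apply: leq_trans (size_polyD _ _) _; rewrite size_polyN geq_max.
    apply/andP; split; apply: leq_trans (size_scale_leq _ _) _.
      by apply: leq_trans (size_polyMleq _ _) _; rewrite size_polyX.
    exact: leq_trans deriv_size (leqW p_size).
  rewrite coefB !coefZ coefXM /= coef_deriv p_coef [p`_ _]nth_default ?mul0rn.
    by rewrite mulr0 subr0.
  exact: leqW.
rewrite [power_act _ _ _]act_lie coefZ p_coef add0n !(hornerE, exprD).
split=> //; exact: leq_trans (size_scale_leq _ _) p_size.
Qed.

Hypothesis F_inf : infinite_set [set: F].

(** Among the products with nonzero coefficient, take those with the largest
    number q of letters and look at the coefficient of X^q: it is a combination
    of monic polynomials in t of distinct degrees, whose leading term survives. *)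
Lemma standard_independent (r : seq (seq (nat * nat)))
    (k : seq (nat * nat) -> F) :
  uniq r -> {in r, forall s, standard N s /\ ((size s).*2 < D)%N} ->
  (forall t, \sum_(s <- r) k s *: power_act t (tableau_monomial x N s) 1 = 0) ->
  {in r, forall s, k s = 0}.
Proof.
move=> r_uniq r_std sum0 s0 s0r; apply/eqP/negPn/negP => ks0.
pose r1 := [seq s <- r | k s != 0].
have s0r1 : s0 \in r1 by rewrite mem_filter ks0.
have [s1 s1r1 s1_max] := exists_max_seq (singles N) s0r1.
set q := singles N s1 in s1_max.
pose r2 := [seq s <- r1 | singles N s == q].
have s1r2 : s1 \in r2 by rewrite mem_filter eqxx.
pose deg s := (\sum_(b <- s) bracket_degree D N b)%N.
have [s2 s2r2 s2_max] := exists_max_seq deg s1r2.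
have r2P s : s \in r2 -> [/\ singles N s = q, k s != 0, s \in r & valid N s].
  rewrite !mem_filter => /and3P[/eqP sq ks sr]; split=> //.
  by have [/andP[]] := r_std s sr.
pose Q := \sum_(s <- r2) k s *: tableau_poly F D N s.
have Q0 : Q = 0.
  apply: infinite_poly_eq0 => // t.
  have := congr1 (fun p : {poly F} => p`_q) (sum0 t); rewrite coef0 => <-.
  rewrite coef_sum /Q horner_sum big_filter /r1 big_filter_cond big_seq_cond.
  rewrite [RHS]big_seq_cond.
  rewrite [RHS](bigID (fun s => (k s != 0) && (singles N s == q))).
  rewrite /= [X in _ = _ + X]big1 ?addr0.
    apply: eq_big => [s|s /andP[sr /andP[_ /eqP sq]]].
      by rewrite andbT.
    have [/andP[s_valid _] _] := r_std s sr.
    have [_] := power_act_tableau t s_valid.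
    by rewrite sq hornerZ coefZ => ->.
  move=> s /andP[/andP[sr _]]; rewrite negb_and negbK => /orP[/eqP ->|neq_q].
    by rewrite scale0r coef0.
  have [->|ks] := eqVneq (k s) 0; first by rewrite scale0r coef0.
  have [/andP[s_valid _] _] := r_std s sr.
  have [s_size _] := power_act_tableau t s_valid.
  rewrite coefZ nth_default ?mulr0 //; apply: leq_trans s_size _.
  have sq : (singles N s <= q)%N by apply: s1_max; rewrite mem_filter ks.
  by rewrite ltn_neqAle neq_q.
have [s2q ks2 s2r s2_valid] := r2P s2 s2r2.
have := congr1 (fun p : {poly F} => p`_(deg s2)) Q0.
rewrite coef0 coef_sum (bigD1_seq s2) /= ?filter_uniq //.
rewrite big_seq_cond big1 ?addr0 => [|s /andP[sr2 s_neq]].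
  have [s2_mon s2_size] := tableau_poly_monic F D_gt1 s2_valid.
  have -> : deg s2 = (size (tableau_poly F D N s2)).-1 by rewrite s2_size.
  rewrite coefZ -lead_coefE (monicP s2_mon) mulr1 => /eqP.
  by rewrite (negPf ks2).
have [sq ks sr s_valid] := r2P s sr2.
have [_ s_size] := tableau_poly_monic F D_gt1 s_valid.
rewrite coefZ nth_default ?mulr0 // s_size ltn_neqAle s2_max // andbT.
apply: contra s_neq => /eqP deg_eq; apply/eqP.
have [[std1 D1] [std2 D2]] := (r_std s sr, r_std s2 s2r).
by apply: weight_inj D1 D2 std1 std2 _; rewrite !weightE sq s2q; congr (_ + _)%N.
Qed.

End Independence.

Section Regrouping.
Local Open Scope ring_scope.
Variables (F : fieldType) (V : lmodType F) (T : eqType) (G : T -> V).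

Lemma group_terms (r : seq (F * T)) :
  \sum_(t <- r) t.1 *: G t.2 =
  \sum_(s <- undup [seq t.2 | t <- r]) (\sum_(t <- r | t.2 == s) t.1) *: G s.
Proof.
under [RHS]eq_bigr do rewrite scaler_suml.
rewrite (exchange_big_dep predT) //= big_seq [RHS]big_seq.
apply: eq_bigr => t tr; rewrite big_mkcond (bigD1_seq t.2) ?undup_uniq //=.
  rewrite eqxx big1 ?addr0 // => s.
  by rewrite eq_sym => /negPf ->.
by rewrite mem_undup map_f.
Qed.

End Regrouping.

Theorem proposition7p2 (F : fieldType) (f : freealg F nat) :
  infinite_set [set: F] ->
  weak_identity (weyl_V F) f ->
  fdegree f = 5 ->
  f \in weyl_L_ideal F.
Proof.
move=> F_inf f_id _; apply/mem_set/basic_relation_L_ideal.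
have [N [r r_std]] := freealg_straightens f.
pose e := undup [seq t.2 | t <- r].
pose k s := (\sum_(t <- r | t.2 == s) t.1)%R.
pose h := (\sum_(s <- e) k s *: tableau_monomial (@fvar F nat) N s)%R.
rewrite group_terms => f_h; change (cong (@fvar F nat) f h) in f_h.
suff h0 : h = 0%R by move: f_h; rewrite h0 /cong subr0.
(* Every row entry occurs at most as often as there are entries, so this base
   leaves no carries; it is also at least 2. *)
pose D := (\max_(s <- e) (size s).*2).+2.
have D_gt1 : 1 < D by [].
have e_std : {in e, forall s, standard N s /\ (size s).*2 < D}.
  move=> s se; split; last first.
    apply/ltnW; rewrite !ltnS.
    exact: (@leq_bigmax_seq _ _ predT (fun s => (size s).*2)).
  by move: se; rewrite mem_undup => /mapP[t /(allP r_std) tP ->].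
have h_act t : (\sum_(s <- e) k s *: power_act D N t
                 (tableau_monomial (@fvar F nat) N s) 1 = 0)%R.
  have := act_ideal (fun i => t ^+ (D ^ i))%R
                    (fun i => t ^+ (D ^ (N + i)))%R 1 f_h.
  rewrite actB act_weak_identity // sub0r => /eqP; rewrite oppr_eq0 => /eqP h0.
  rewrite -[RHS]h0 act_sum; apply: eq_bigr => s _; exact/esym/actZ.
have k0 := standard_independent D_gt1 F_inf (undup_uniq _) e_std h_act.
by rewrite /h big_seq big1 // => s /k0 ->; rewrite scale0r.
Qed.
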